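(* Let $\mathcal{U}_a\subseteq\mathcal{U}$ and $\mathcal{Y}_a\subseteq\mathcal{Y}$ be attacked actuators and (unprotected) attacked sensors, respectively, let $u_i\in\mathcal{U}_a$, and let $$\mathcal{X}_a=\{x_j\in\mathcal{X}:(u_k,x_j)\in\mathcal{E}_{ux},\ u_k\in\mathcal{U}_a\setminus\{u_i\}\}.$$ The Type 2 attacker can conduct a perfectly undetectable attack in which $u_i$ is actively used in any realization of $[A],[B],[C]$ if and only if $\mathcal{X}_a\cup\mathcal{Y}_a$ is a vertex separator of $u_i$ and $t$ in $\mathcal{G}_t$.
   Context: System. For real matrices $A\in\mathbb{R}^{n_x\times n_x}$, $B\in\mathbb{R}^{n_x\times n_u}$, $C\in\mathbb{R}^{(n_y+n_e)\times n_x}$, consider, for $k\in\mathbb{Z}_{\ge0}$, $x(k+1)=Ax(k)+Bu(k)+B_a a(k)$, $y(k)=Cx(k)+D_a a(k)$, with $x(0)=0$ and $u=0$, where $$B_a=\begin{bmatrix} B & \mathbf{0}_{n_x\times n_y}\end{bmatrix},\qquad D_a=\begin{bmatrix}\mathbf{0}_{n_y\times n_u} & \mathbf{I}_{n_y}\\ \mathbf{0}_{n_e\times n_u} & \mathbf{0}_{n_e\times n_y}\end{bmatrix}.$$ The first $n_u$ entries $a^{(u_j)}$ of the attack $a(k)\in\mathbb{R}^{n_u+n_y}$ act on the actuators $u_1,\dots,u_{n_u}$ and the last $n_y$ entries $a^{(y_l)}$ on the unprotected sensors $y_1,\dots,y_{n_y}$; sensors $y_{n_y+1},\dots,y_{n_y+n_e}$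 are protected and cannot be attacked. An attack $a\neq0$ is perfectly undetectable if $y(k)=0$ for all $k$; $u_i$ is actively used if $a^{(u_i)}(k)\neq0$ for at least one $k$. Structural model. $[A],[B],[C]$ are binary matrices of the same sizes as $A,B,C$. A realization is a triple of real matrices $A,B,C$ whose entries are $0$ wherever the corresponding structural entry is $0$, and arbitrary real numbers where it is $1$, subject to the standing assumption ($e_i$ canonical basis vectors): (1) $[B]=[e_{i_1}\cdots e_{i_{n_u}}]$; (2) $[B]$ has full column rank; (3) if $[B](i,j)=1$ then $B(i,j)\neq0$ in every realization; (4) $[C]=[e_{j_1}\cdots e_{j_{n_y+n_e}}]^T$. Graph. $\mathcal{X}=\{x_1,\dots,x_{n_x}\}$, $\mathcal{U}=\{u_1,\dots,u_{n_u}\}$, $\mathcal{Y}=\{y_1,\dots,y_{n_y+n_e}\}$. $\mathcal{E}_{ux}=\{(u_j,x_i):[B](i,j)\ne0\}$, $\mathcal{E}_{xx}=\{(x_j,x_i):[A](i,j)\neq0\}$, $\mathcal{E}_{xy}=\{(x_j,y_i):[C](i,j)\ne0\}$. The extended graph $\mathcal{G}_t$ is the directed graph with nodes $\mathcal{X}\cup\mathcal{U}\cup\mathcal{Y}\cup\{t\}$ and edges $\mathcal{E}_{ux}\cup\mathcal{E}_{xx}\cup\mathcal{E}_{xy}\cup\{(y_i,t):y_i\in\mathcal{Y}\}$. Two nodes are adjacent if there is an edge between them. A vertex separator of non-adjacent nodes $v_a,v_b$ is a set of nodes not containing $v_a,v_b$ whose removal deletes all directed paths from $v_a$ to $v_b$.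 $\mathcal{N}^{\text{in}}_{v}$ is the set of nodes with an edge into $v$. Type 2 attacker (with attacked components $\mathcal{U}_a,\mathcal{Y}_a$). The attacker: (1) can read and change the values of the attacked control signals $\mathcal{U}_a$ and measurements $\mathcal{Y}_a$ arbitrarily; (2) knows $[A],[B],[C]$ and the rows $A(j,:)$, $B(j,:)$ for every state $x_j$ adjacent to an actuator from $\mathcal{U}_a$; (3) knows at every time $k$ the value $x_j(k)$ for every $x_j$ adjacent to an actuator from $\mathcal{U}_a$, and $x_l(k)$ for every state $x_l\in\mathcal{N}^{\text{in}}_{x_j}$; (4) wants to ensure that the attack remains perfectly undetectable. Thus an attack of the Type 2 attacker is given by a policy in which $a(k)$ is supported on $\mathcal{U}_a\cup\mathcal{Y}_a$ and is a function only of $k$, the information in (2), and the values at times up to $k$ of the states in (3) and of the unaltered measurements $C(l,:)x$ of the attacked sensors $y_l\in\mathcal{Y}_a$. ''Can conduct a perfectly undetectable attack in which $u_i$ is actively used in any realization'' means that there is such a policy for which, in every realization $A,B,C$, the resulting attack signal is perfectly undetectable and has $a^{(u_i)}\neq0$. *)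

(* Defs.v *)
From HB Require Import structures.
From mathcomp Require Import all_boot all_order all_algebra.
From mathcomp Require Import reals.

Set Implicit Arguments.
Unset Strict Implicit.
Unset Printing Implicit Defensive.

Import Order.TTheory GRing.Theory Num.Theory.
Local Open Scope ring_scope.

Section Digraph.
Variables (V : finType) (e : rel V).
Implicit Types (S : {set V}) (v w : V).

Definition adjacent v w := e v w || e w v.

Definition remove_nodes S : rel V :=
  [rel v w | [&& v \notin S, w \notin S & e v w]].

Definition vertex_separator S v w :=
  [&& ~~ adjacent v w, v \notin S, w \notin S & ~~ connect (remove_nodes S) v w].

End Digraph.

(* The sensors 0, ..., ny - 1 (of the form [lshift ne l]) are unprotected, the
   sensors ny, ..., ny + ne - 1 are protected. *)
Inductive node (nx nu ny ne : nat) :=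
  | StateN of 'I_nx
  | ActuatorN of 'I_nu
  | SensorN of 'I_(ny + ne)
  | SinkN.

Arguments StateN {nx nu ny ne} _.
Arguments ActuatorN {nx nu ny ne} _.
Arguments SensorN {nx nu ny ne} _.
Arguments SinkN {nx nu ny ne}.

Section NodeFinite.
Variables nx nu ny ne : nat.
Local Notation node := (node nx nu ny ne).

Definition node_encode (v : node) :
    'I_nx + 'I_nu + 'I_(ny + ne) + unit :=
  match v with
  | StateN j => inl (inl (inl j))
  | ActuatorN j => inl (inl (inr j))
  | SensorN l => inl (inr l)
  | SinkN => inr tt
  end.

Definition node_decode (c : 'I_nx + 'I_nu + 'I_(ny + ne) + unit) : node :=
  match c with
  | inl (inl (inl j)) => StateN j
  | inl (inl (inr j)) => ActuatorN j
  | inl (inr l) => SensorN l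
  | inr _ => SinkN
  end.

Lemma node_encodeK : cancel node_encode node_decode.
Proof. by case. Qed.

HB.instance Definition _ := Finite.copy node (can_type node_encodeK).

End NodeFinite.

Section Structure.
Variables nx nu ny ne : nat.
Variables (SA : 'M[bool]_nx) (SB : 'M[bool]_(nx, nu)).
Variable SC : 'M[bool]_(ny + ne, nx).

Definition extended_edge (v w : node nx nu ny ne) : bool :=
  match v, w with
  | ActuatorN j, StateN i => SB i j
  | StateN j, StateN i => SA i j
  | StateN j, SensorN i => SC i j
  | SensorN _, SinkN => true
  | _, _ => false
  end.

Definition driven_states (W : {set 'I_nu}) : {set 'I_nx} :=
  [set j | [exists k in W, SB j k]].

Definition known_states (W : {set 'I_nu}) : {set 'I_nx} :=
  driven_states W :|: [set l | [exists j in driven_states W, SA j l]].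

Definition state_sensor_nodes (Xa : {set 'I_nx}) (Ya : {set 'I_ny}) :
    {set node nx nu ny ne} :=
  [set StateN j | j in Xa]
    :|: [set SensorN (lshift ne l) | l in Ya].

(* The further requirement that B vanishes at no nonzero entry of [SB] constrains
   the real matrices, and so is part of [realization]. *)
Definition standing_assumption (R : realType) : Prop :=
  [/\ exists s : 'I_nu -> 'I_nx, SB = \matrix_(i, j) (i == s j),
      \rank (map_mx (fun b : bool => b%:R : R) SB) = nu
    & exists s : 'I_(ny + ne) -> 'I_nx, SC = \matrix_(i, j) (j == s i)].

Definition realization (R : realType) (A : 'M[R]_nx) (B : 'M[R]_(nx, nu))
    (C : 'M[R]_(ny + ne, nx)) : Prop :=
  [/\ forall i j, ~~ SA i j -> A i j = 0,
      forall i j, ~~ SB i j -> B i j = 0,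
      forall i j, SB i j -> B i j != 0
    & forall i j, ~~ SC i j -> C i j = 0].

End Structure.

Section Dynamics.
Variables (R : realType) (nx nu ny ne : nat).
Variables (A : 'M[R]_nx) (B : 'M[R]_(nx, nu)) (C : 'M[R]_(ny + ne, nx)).

Definition attack_signal := nat -> 'cV[R]_(nu + ny).
Implicit Type a : attack_signal.

Definition Ba : 'M[R]_(nx, nu + ny) := row_mx B 0.
Definition Da : 'M[R]_(ny + ne, nu + ny) := block_mx 0 1%:M 0 0.

(* The control input u is identically 0 and hence omitted. *)
Fixpoint state a (k : nat) : 'cV[R]_nx :=
  if k is k'.+1 then A *m state a k' + Ba *m a k' else 0.

Definition output a (k : nat) : 'cV[R]_(ny + ne) :=
  C *m state a k + Da *m a k.

Definition perfectly_undetectable a : Prop :=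
  (exists k, a k != 0) /\ (forall k, output a k = 0).

Definition actively_used (i : 'I_nu) a : Prop :=
  exists k, a k (lshift ny i) 0 != 0.

End Dynamics.

Section Type2Attacker.
Variables (R : realType) (nx nu ny ne : nat).
Variables (SA : 'M[bool]_nx) (SB : 'M[bool]_(nx, nu)).
Variable SC : 'M[bool]_(ny + ne, nx).
Variables (Ua : {set 'I_nu}) (Ya : {set 'I_ny}).

Definition known_rows (n : nat) := {j | j \in driven_states SB Ua} -> 'rV[R]_n.

Definition reveal_rows (n : nat) (M : 'M[R]_(nx, n)) : known_rows n :=
  fun j => row (val j) M.

Record snapshot := Snapshot {
  seen_state : {j | j \in known_states SA SB Ua} -> R;
  seen_measurement : {l | l \in Ya} -> R
}.

Definition take_snapshot (C : 'M[R]_(ny + ne, nx)) (x : 'cV[R]_nx) :=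
  Snapshot (fun j => x (val j) 0)
           (fun l => (C *m x) (lshift ne (val l)) 0).

(* [pol k rA rB h] is a(k), where rA and rB are the known rows of A and B and h
   is the list of the snapshots at times 0, ..., k. *)
Definition policy :=
  nat -> known_rows nx -> known_rows nu -> seq snapshot -> 'cV[R]_(nu + ny).

Definition supported (pol : policy) : Prop :=
  forall k rA rB h,
    (forall j : 'I_nu, j \notin Ua -> pol k rA rB h (lshift ny j) 0 = 0) /\
    (forall l : 'I_ny, l \notin Ya -> pol k rA rB h (rshift nu l) 0 = 0).

Definition generated_attack (pol : policy) (A : 'M[R]_nx) (B : 'M[R]_(nx, nu))
    (C : 'M[R]_(ny + ne, nx)) (a : attack_signal R nu ny) : Prop :=
  forall k, a k = pol k (reveal_rows A) (reveal_rows B)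
                    (mkseq (fun m => take_snapshot C (state A B a m)) k.+1).

(* The state at time m depends on a(0), ..., a(m - 1) only, so the loop closed
   by a policy determines the attack signal. *)
Lemma generated_attack_unique pol A B C a a' :
  generated_attack pol A B C a -> generated_attack pol A B C a' -> a =1 a'.
Proof.
move=> ga ga'.
have eq_below k : forall m, (m < k)%N -> a m = a' m.
  elim: k => // k IHk m; rewrite ltnS => le_mk.
  have eq_state p : (p <= k)%N -> state A B a p = state A B a' p.
    elim: p => //= p IHp lt_pk.
    by rewrite IHp ?IHk // ltnW.
  rewrite ga ga'; congr (pol _ _ _ _).
  apply/eq_in_map => p; rewrite mem_iota /= add0n ltnS => le_pm.
  by rewrite eq_state // (leq_trans le_pm).
by move=> k; apply: (eq_below k.+1).
Qed.

Definition type2_can_conduct (i : 'I_nu) : Prop :=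
  exists2 pol : policy, supported pol &
    forall A B C, realization SA SB SC A B C ->
      exists a, [/\ generated_attack pol A B C a,
                    perfectly_undetectable A B C a
                  & actively_used i a].

End Type2Attacker.

(* Main.v *)
Require Import Defs.
From mathcomp Require Import all_boot all_order all_algebra.
From mathcomp Require Import reals.

(* If [Xa :|: Ya] separates [u_i] from [t], the attacker feeds 1 into [u_i] at
   all times, uses the other attacked actuators to reset every state of [Xa] to 0
   (their dynamics are known locally), and subtracts the true measurement at every
   attacked sensor. By induction on time, a nonzero state is reachable from [u_i]
   outside the separator, so no unattacked sensor ever sees one.
   Conversely, if a simple path from [u_i] to [t] avoids [Xa :|: Ya], consider the
   realization in which the edges of that path are the only nonzero entries of [A]:
   there the path is a pure delay line, at the end of which an unattacked sensor
   outputs the signal injected in [u_i]; undetectability makes it vanish. *)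

Set Implicit Arguments.
Unset Strict Implicit.
Unset Printing Implicit Defensive.

Import Order.TTheory GRing.Theory Num.Theory.
Local Open Scope ring_scope.

(** * Rank of a selection matrix and membership in the separator *)

(** Full column rank makes the rows of the transpose linearly independent, hence distinct, while
    equal values of [s] would make two of them coincide. *)
Lemma selection_rank_inj (F : fieldType) (m n : nat) (s : 'I_n -> 'I_m) :
  \rank (\matrix_(r < m, c < n) (r == s c)%:R : 'M[F]_(m, n)) = n -> injective s.
Proof.
set M := \matrix_(r, c) _ => rkM c1 c2 eq_s.
have freeM : row_free M^T by rewrite /row_free mxrank_tr rkM.
have : row c1 M^T = row c2 M^T by apply/rowP => r; rewrite !mxE eq_s.
rewrite !rowE => /(row_free_inj freeM) /rowP /(_ c1).
by rewrite !mxE !eqxx /=; case: eqP => // _ /eqP; rewrite oner_eq0.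
Qed.

Lemma remove_nodesE (V : finType) (e : rel V) (S : {set V}) v w :
  remove_nodes e S v w = [&& v \notin S, w \notin S & e v w].
Proof. by []. Qed.

Section Nodes.
Variables (nx nu ny ne : nat) (Xa : {set 'I_nx}) (Ya : {set 'I_ny}).
Local Notation S := (state_sensor_nodes nu ne Xa Ya).

Lemma StateN_separator j : (StateN j \in S) = (j \in Xa).
Proof.
rewrite inE; apply/orP/idP => [[] /imsetP[z zin] // [->] //|jXa].
by left; apply: imset_f.
Qed.

Lemma ActuatorN_separator k : (ActuatorN k \in S) = false.
Proof. by rewrite inE; apply/orP => -[] /imsetP[]. Qed.

Lemma SinkN_separator : (SinkN \in S) = false.
Proof. by rewrite inE; apply/orP => -[] /imsetP[]. Qed.

Lemma SensorN_separator l : (SensorN l \in S) = (l \in [set lshift ne z | z in Ya]).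
Proof.
rewrite inE; apply/orP/imsetP => [[] /imsetP[z zin] // [->]|[z zYa ->]].
  by exists z.
by right; apply/imsetP; exists z.
Qed.

End Nodes.

(** * Closed-loop dynamics of a fixed realization *)

Section Loop.
Variables (R : realType) (nx nu ny ne : nat).
Variables (SA : 'M[bool]_nx) (SB : 'M[bool]_(nx, nu)) (SC : 'M[bool]_(ny + ne, nx)).
Variables (A : 'M[R]_nx) (B : 'M[R]_(nx, nu)) (C : 'M[R]_(ny + ne, nx)).
Hypothesis realABC : realization SA SB SC A B C.

Lemma Ba_mul (a : 'cV[R]_(nu + ny)) j :
  (Ba ny B *m a) j 0 = \sum_k B j k * a (lshift ny k) 0.
Proof.
rewrite -{1}(vsubmxK a) mul_row_col mul0mx addr0 mxE.
by apply: eq_bigr => k _; rewrite mxE.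
Qed.

Lemma Ba_mul_single (a : 'cV[R]_(nu + ny)) j k :
  (forall k', SB j k' -> a (lshift ny k') 0 != 0 -> k' = k) ->
  (Ba ny B *m a) j 0 = B j k * a (lshift ny k) 0.
Proof.
case: realABC => _ B0 _ _ single.
rewrite Ba_mul (bigD1 k) //= big1 ?addr0 // => k' neq_k'k.
case: (boolP (SB j k')) => [jk'|/B0 ->]; last by rewrite mul0r.
have [->|/(single _ jk') eq_k'k] := eqVneq (a (lshift ny k') 0) 0.
  by rewrite mulr0.
by rewrite eq_k'k eqxx in neq_k'k.
Qed.

Lemma Ba_mul_undriven (a : 'cV[R]_(nu + ny)) j :
  (forall k, SB j k -> a (lshift ny k) 0 = 0) -> (Ba ny B *m a) j 0 = 0.
Proof.
case: realABC => _ B0 _ _ undriven; rewrite Ba_mul big1 // => k _.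
by case: (boolP (SB j k)) => [/undriven|/B0] ->; rewrite ?mulr0 ?mul0r.
Qed.

Lemma output_lshift (a : attack_signal R nu ny) k l :
  output A B C a k (lshift ne l) 0
  = (C *m state A B a k) (lshift ne l) 0 + a k (rshift nu l) 0.
Proof.
rewrite /output mxE; congr (_ + _).
rewrite -{1}(vsubmxK (a k)) /Da mul_block_col !mul0mx mul1mx add0r.
by rewrite col_mxEu mxE.
Qed.

Lemma output_rshift (a : attack_signal R nu ny) k l :
  output A B C a k (rshift ny l) 0 = (C *m state A B a k) (rshift ny l) 0.
Proof.
rewrite /output mxE -{1}(vsubmxK (a k)) /Da mul_block_col !mul0mx.
by rewrite col_mxEd !mxE !addr0.
Qed.

Lemma output_unattacked (Ya : {set 'I_ny}) (a : attack_signal R nu ny) k l :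
  (forall z, z \notin Ya -> a k (rshift nu z) 0 = 0) ->
  l \notin [set lshift ne z | z in Ya] ->
  output A B C a k l 0 = (C *m state A B a k) l 0.
Proof.
move=> suppYa; case: (split_ordP l) => z ->; last by rewrite output_rshift.
rewrite output_lshift => zYa; rewrite suppYa ?addr0 //.
by apply: contra zYa => zYa; apply: imset_f.
Qed.

(** A feedback that reads only the current snapshot turns the loop into an autonomous recursion on
    the state, iterated from 0. The default [w] is never reached, as the history at time [k] has
    [k.+1] entries. *)
Lemma memoryless_generated (Ua : {set 'I_nu}) (Ya : {set 'I_ny})
    (F : known_rows R SB Ua nx -> known_rows R SB Ua nu ->
         snapshot R SA SB Ua Ya -> 'cV[R]_(nu + ny)) w :
  exists a, generated_attack (fun k rA rB h => F rA rB (nth w h k)) A B C a.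
Proof.
pose u x := F (reveal_rows A) (reveal_rows B) (take_snapshot SA SB Ua Ya C x).
pose x k := iter k (fun x => A *m x + Ba ny B *m u x) 0.
exists (fun k => u (x k)) => k; rewrite nth_mkseq //.
suff -> : state A B (fun k => u (x k)) k = x k by [].
by elim: k => //= k ->.
Qed.

End Loop.

(** * The separator for a fixed actuator [i], where [s] gives the state that each actuator drives *)

Section Separator.
Variables (R : realType) (nx nu ny ne : nat).
Variables (SA : 'M[bool]_nx) (SB : 'M[bool]_(nx, nu)) (SC : 'M[bool]_(ny + ne, nx)).
Variables (Ua : {set 'I_nu}) (Ya : {set 'I_ny}) (i : 'I_nu) (s : 'I_nu -> 'I_nx).
Hypotheses (SBE : forall j k, SB j k = (j == s k)) (s_inj : injective s).
Hypothesis Ua_i : i \in Ua.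

Local Notation S := (state_sensor_nodes nu ne (driven_states SB (Ua :\ i)) Ya).
Local Notation edge := (remove_nodes (extended_edge SA SB SC) S).

Lemma driven_actuator k (W : {set 'I_nu}) : (s k \in driven_states SB W) = (k \in W).
Proof.
rewrite inE; apply/existsP/idP => [[k' /andP[k'W]]|kW].
  by rewrite SBE => /eqP/s_inj->.
by exists k; rewrite kW SBE eqxx.
Qed.

Lemma driven_statesP j (W : {set 'I_nu}) :
  reflect (exists2 k, k \in W & j = s k) (j \in driven_states SB W).
Proof.
apply: (iffP idP) => [|[k kW ->]]; last by rewrite driven_actuator.
by rewrite inE => /existsP[k /andP[kW]]; rewrite SBE => /eqP; exists k.
Qed.

(** * Sufficiency: the cancelling attack *)

Section Cancelling.

Local Notation snap := (snapshot R SA SB Ua Ya).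

(** Unknown states are filled with 0, which leaves the products below unchanged because the rows of
    [A] at driven states vanish there. *)
Definition known_part (w : snap) : 'cV[R]_nx :=
  \col_l oapp (seen_state w) 0 (insub l).

(** For attacked [k] other than [i], the entry is the input that cancels the drift of state [s k].
    The [insub] defaults put 0 on unattacked components. *)
Definition cancelling_input (rA : known_rows R SB Ua nx)
    (rB : known_rows R SB Ua nu) (w : snap) : 'cV[R]_(nu + ny) :=
  col_mx
    (\col_k if k == i then 1
            else oapp (fun j => - (rA j *m known_part w) 0 0 / rB j 0 k) 0
                      (insub (s k)))
    (\col_l oapp (fun l => - seen_measurement w l) 0 (insub l)).

Definition cancelling_policy : policy R SA SB Ua Ya := fun k rA rB h =>
  cancelling_input rA rB (nth (Snapshot (fun=> 0) (fun=> 0)) h k).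

Lemma cancelling_policy_supported : supported cancelling_policy.
Proof.
move=> k rA rB h; split=> [k' k'Ua|l lYa].
  rewrite col_mxEu mxE; case: eqP => [eq_k'i|_]; first by rewrite eq_k'i Ua_i in k'Ua.
  by rewrite insubF // driven_actuator; apply: negbTE.
by rewrite col_mxEd mxE insubF //; apply: negbTE.
Qed.

Variables (A : 'M[R]_nx) (B : 'M[R]_(nx, nu)) (C : 'M[R]_(ny + ne, nx)).
Hypothesis realABC : realization SA SB SC A B C.
Variable a : attack_signal R nu ny.
Hypothesis gen_a : generated_attack cancelling_policy A B C a.
Local Notation x := (state A B a).

Lemma cancelling_attackE k :
  a k = cancelling_input (reveal_rows A) (reveal_rows B)
          (take_snapshot SA SB Ua Ya C (x k)).
Proof. by rewrite gen_a /cancelling_policy nth_mkseq. Qed.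

Lemma cancelling_attack_i k : a k (lshift ny i) 0 = 1.
Proof. by rewrite cancelling_attackE col_mxEu mxE eqxx. Qed.

Lemma cancelling_attack_supp k k' : k' \notin Ua -> a k (lshift ny k') 0 = 0.
Proof. by move=> k'Ua; rewrite gen_a; apply: (cancelling_policy_supported _ _ _ _).1. Qed.

Lemma cancelling_attack_actuator k k' : k' \in Ua :\ i ->
  B (s k') k' * a k (lshift ny k') 0 = - (A *m x k) (s k') 0.
Proof.
rewrite !inE => /andP[neq_k'i k'Ua]; have [A0 _ Bn0 _] := realABC.
have drv : s k' \in driven_states SB Ua by rewrite driven_actuator.
rewrite cancelling_attackE col_mxEu mxE (negbTE neq_k'i) (insubT (mem (driven_states SB Ua)) drv) /=.
rewrite /reveal_rows /= !mxE mulrC mulfVK; last by apply: Bn0; rewrite SBE.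
congr (- _); apply: eq_bigr => l _; rewrite mxE.
have [->|nz] := eqVneq (A (s k') l) 0; first by rewrite !mul0r.
(* A nonzero entry of this row comes from an edge into a driven state, so its source is known. *)
have knl : l \in known_states SA SB Ua.
  rewrite !inE; apply/orP; right; apply/existsP; exists (s k').
  by rewrite drv; apply: contraR nz => /A0->.
by rewrite mxE (insubT (mem (known_states SA SB Ua)) knl).
Qed.

(** By injectivity of [s], each such state is driven by one actuator only, whose input exactly
    offsets the drift; at time 0 the state is 0 anyway. *)
Lemma cancelled_state k j : j \in driven_states SB (Ua :\ i) -> x k j 0 = 0.
Proof.
case/driven_statesP => k' k'Ua ->; case: k => [|k] /=; first by rewrite mxE.
rewrite mxE (Ba_mul_single realABC (k := k')); last first.
  by move=> k'' + _; rewrite SBE => /eqP/s_inj.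
by rewrite cancelling_attack_actuator // addrN.
Qed.

(** Cancelled states vanish, so a nonzero state lies outside [S]. Its value stems from [u_i]
    directly or from a nonzero state one step earlier, which is reachable by induction on time. *)
Lemma nonzero_state_reachable k j : x k j 0 != 0 -> connect edge (ActuatorN i) (StateN j).
Proof.
have [A0 _ _ _] := realABC.
have notin_S m l : x m l 0 != 0 -> StateN l \notin S.
  by move=> nz; rewrite StateN_separator; apply: contra nz => /cancelled_state->.
elim: k j => [|k IHk] j nz; first by rewrite /= mxE eqxx in nz.
have jS := notin_S _ _ nz.
case: (boolP (SB j i)) => [ij|nij].
  by apply: connect1; rewrite remove_nodesE /= ActuatorN_separator jS.
(* No input reaches [j]: an attacked actuator other than [i] would put [j] in the separator. *)
have : (A *m x k) j 0 != 0.
  apply: contra nz => /eqP Axj0; rewrite /= mxE Axj0 add0r.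
  rewrite (Ba_mul_undriven realABC) // => k' jk'.
  apply: cancelling_attack_supp; apply: contra jS => k'Ua.
  rewrite StateN_separator; apply/driven_statesP; exists k'; last first.
    by apply/eqP; rewrite -SBE.
  by rewrite !inE k'Ua andbT; apply: contraNneq nij => <-.
rewrite mxE; case: (pickP (fun l => A j l * x k l 0 != 0)) => [l nzl _|all0]; last first.
  by rewrite big1 ?eqxx // => l _; apply/eqP/negbFE/all0.
move: nzl; rewrite mulf_eq0 negb_or => /andP[nzA nzx].
apply: connect_trans (IHk _ nzx) (connect1 _).
by rewrite remove_nodesE /= jS (notin_S _ _ nzx); apply: contraR nzA => /A0->.
Qed.

(** Attacked sensors output 0 by subtraction. A nonzero reading elsewhere needs a nonzero state
    outside [S], and the sensor would complete a path to [t]. *)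
Lemma cancelling_attack_undetectable :
  ~~ connect edge (ActuatorN i) SinkN -> forall k, output A B C a k = 0.
Proof.
move=> sep k; have [_ _ _ C0] := realABC.
apply/matrixP => l c; rewrite ord1 [RHS]mxE {c}.
case: (boolP (l \in [set lshift ne z | z in Ya])) => [/imsetP[z zYa ->]|lYa].
  by rewrite output_lshift cancelling_attackE col_mxEd [X in _ + X]mxE (insubT (mem Ya) zYa) /= addrN.
rewrite (output_unattacked _ _ _ _ lYa); last first.
  by move=> z zYa; rewrite gen_a; apply: (cancelling_policy_supported _ _ _ _).2.
rewrite mxE big1 // => j _; apply/eqP; apply: contraNT sep.
rewrite mulf_eq0 negb_or => /andP[nzC nzx].
have jS : StateN j \notin S.
  by rewrite StateN_separator; apply: contra nzx => /cancelled_state->.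
have lS : SensorN l \notin S by rewrite SensorN_separator.
apply: connect_trans (nonzero_state_reachable nzx) _.
apply: (connect_trans (y := SensorN l)); apply: connect1.
  by rewrite remove_nodesE /= jS lS; apply: contraR nzC => /C0->.
by rewrite remove_nodesE /= lS SinkN_separator.
Qed.

End Cancelling.

Lemma separator_can_conduct :
  ~~ connect edge (ActuatorN i) SinkN -> type2_can_conduct R SA SB SC Ua Ya i.
Proof.
move=> sep; exists cancelling_policy; first exact: cancelling_policy_supported.
move=> A B C realABC.
have [a gen_a] := memoryless_generated A B C cancelling_input (Snapshot (fun=> 0) (fun=> 0)).
have nz : a 0%N (lshift ny i) 0 != 0 by rewrite (cancelling_attack_i gen_a) oner_eq0.
exists a; split; [exact: gen_a | split | by exists 0%N].
  by exists 0%N; apply: contra nz => /eqP->; rewrite mxE.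
exact: (cancelling_attack_undetectable realABC gen_a).
Qed.

(** * Necessity: the delay-line realization *)

Section DelayLine.
Variable p : seq (node nx nu ny ne).
Hypotheses (path_p : path edge (ActuatorN i) p) (uniq_p : uniq (ActuatorN i :: p)).
Local Notation q := (ActuatorN i :: p).

(** Consecutive positions in [q] encode the edges of the path, so that each state on it copies its
    predecessor. *)
Definition path_A : 'M[R]_nx := \matrix_(j, l)
  [&& SA j l, StateN l \in q & index (StateN j) q == (index (StateN l) q).+1]%:R.
Definition full_B : 'M[R]_(nx, nu) := map_mx (fun b : bool => b%:R) SB.
Definition full_C : 'M[R]_(ny + ne, nx) := map_mx (fun b : bool => b%:R) SC.

Lemma delay_line_realization : realization SA SB SC path_A full_B full_C.
Proof.
split=> j l; rewrite mxE; [|by move/negbTE-> | by move->; rewrite oner_eq0 | by move/negbTE->].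
by move/negbTE->.
Qed.

Variable a : attack_signal R nu ny.
Hypothesis supp_a : forall k k', k' \notin Ua -> a k (lshift ny k') 0 = 0.
Local Notation x := (state path_A full_B a).

Lemma path_edge r : (r < size p)%N -> edge (nth SinkN q r) (nth SinkN p r).
Proof. by move/pathP: path_p; apply. Qed.

(** As [q] has no repetition, [index] inverts [nth]. Position [r] of [p] is position [r.+1] of [q],
    so [nth SinkN q r] is the predecessor. *)
Lemma path_A_pred r j l : (r < size p)%N -> nth SinkN p r = StateN j ->
  path_A j l = (nth SinkN q r == StateN l)%:R.
Proof.
move=> lt_rp rj; rewrite mxE; congr (nat_of_bool _)%:R.
have -> : index (StateN j) q = r.+1.
  by rewrite -rj -[nth _ p r]/(nth SinkN q r.+1) index_uniq.
rewrite eqSS; apply/and3P/eqP => [[_ lq /eqP->]|rl]; first by rewrite nth_index.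
have := path_edge lt_rp; rewrite rj rl remove_nodesE /= => /and3P[_ _ lj].
have lt_rq : (r < size q)%N by rewrite ltnS ltnW.
have idx : index (StateN l) q = r by rewrite -rl index_uniq.
by split; [|rewrite -rl mem_nth|apply/eqP/esym/idx].
Qed.

(** Induction along the path: the first state receives the signal from [u_i] one step late, and each
    later state adds one step of delay. *)
Lemma delay_line r j : (r < size p)%N -> nth SinkN p r = StateN j ->
  forall k, x (k + r.+1)%N j 0 = a k (lshift ny i) 0.
Proof.
elim: r j => [|r IHr] j lt_rp rj k; have := path_edge lt_rp; rewrite rj remove_nodesE /=.
  case/and3P=> _ _ ij; rewrite addn1 /= mxE.
  rewrite (Ba_mul_single delay_line_realization (k := i)); last first.
    by move: ij; rewrite SBE => /eqP -> k' + _; rewrite SBE => /eqP/s_inj.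
  (* The predecessor is an actuator, so this row of [path_A] is zero. *)
  rewrite mxE big1 => [|l _]; first by rewrite add0r mxE ij mul1r.
  by rewrite (path_A_pred _ lt_rp rj) mul0r.
case/and3P=> _ jS; have lt_r := ltnW lt_rp.
(* Actuators have no incoming edge, so the predecessor of [j] must be a state. *)
have := path_edge lt_r; rewrite remove_nodesE; case rl: (nth SinkN p r) => [l|k'|y|] //=; last first.
  by case: (nth SinkN q r) => [?|?|?|] /and3P[].
move=> _ lj; rewrite addnS /= mxE (Ba_mul_undriven delay_line_realization); last first.
  (* Attacked actuators other than [i] drive only states of [S], which the path avoids. *)
  move=> k' jk'; apply: supp_a; apply: contra jS => k'Ua.
  rewrite StateN_separator; apply/driven_statesP; exists k'; last first.
    by apply/eqP; rewrite -SBE.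
  rewrite !inE k'Ua andbT; apply/eqP => eq_k'i.
  (* The only state driven by [u_i] is the first on the path, and a simple path cannot return to it
     at position [r.+1]. *)
  have p0 : nth SinkN p 0 = StateN j.
    have := path_edge (leq_ltn_trans (leq0n _) lt_rp).
    case: (nth SinkN p 0) => [j'|?|?|] /and3P[_ _] //=.
    by move: jk'; rewrite eq_k'i !SBE => /eqP -> /eqP ->.
  have uniq_tl : uniq p by case/andP: uniq_p.
  have /eqP := etrans p0 (esym rj).
  by rewrite nth_uniq // (leq_ltn_trans _ lt_rp).
rewrite addr0 mxE (bigD1 l) //= (path_A_pred _ lt_rp rj) /= rl eqxx mul1r.
rewrite IHr // big1 ?addr0 // => l' neq_l'l.
rewrite (path_A_pred _ lt_rp rj) /= rl; case: eqP => [[eq_ll']|_]; last by rewrite mul0r.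
by rewrite eq_ll' eqxx in neq_l'l.
Qed.

End DelayLine.

Lemma can_conduct_separator :
  (forall l, exists j0, forall j, SC l j = (j == j0)) ->
  type2_can_conduct R SA SB SC Ua Ya i -> ~~ connect edge (ActuatorN i) SinkN.
Proof.
move=> SCE [pol supp can]; apply/negP => /connectP[p0 path_p0 last_p0].
case/shortenP: path_p0 last_p0 => p path_p uniq_p _ last_p.
have [a [gen_a [_ out0] [k nz]]] := can _ _ _ (delay_line_realization p).
have supp_a m k' : k' \notin Ua -> a m (lshift ny k') 0 = 0.
  by move=> k'Ua; rewrite gen_a; apply: (supp _ _ _ _).1.
have supp_y m z : z \notin Ya -> a m (rshift nu z) 0 = 0.
  by move=> zYa; rewrite gen_a; apply: (supp _ _ _ _).2.
have line := delay_line path_p uniq_p supp_a.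
(* Only sensors lead to [t] and only states lead to sensors, so the path ends with a state [j], a
   sensor [l] and [t]. *)
case/lastP: p path_p last_p line out0 {uniq_p gen_a} => // p1 t path_p.
rewrite last_rcons => eq_t; rewrite -{t}eq_t in path_p *.
move: path_p; rewrite rcons_path => /andP[].
case/lastP: p1 => [|p2 v]; first by rewrite /= remove_nodesE /= !andbF.
rewrite rcons_path last_rcons; case: v => [?|?|l|]; rewrite !remove_nodesE /= ?andbF //.
case/andP=> _; case/lastP: p2 => [|p3 v]; first by rewrite /= !andbF.
rewrite last_rcons; case: v => [j|?|?|] /and3P[_ lS] //= lj.
move=> _ line out0.
have := line (size p3) j; rewrite !size_rcons !nth_rcons !size_rcons !ltnS.
rewrite leqnn eqxx ltnn !leqW // => /(_ isT erefl k) xj.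
(* At this time [j], at position [size p3] of the path, carries the nonzero value injected at time
   [k]. *)
have := out0 (k + (size p3).+1)%N.
rewrite SensorN_separator in lS.
move=> /matrixP/(_ l 0); rewrite (output_unattacked _ _ _ (@supp_y _) lS).
rewrite [RHS]mxE mxE (bigD1 j) //= big1 => [|j' neq_j'j].
  by rewrite mxE lj mul1r addr0 xj // => /eqP; apply/negP.
(* Sensor [l] measures a single state, so no other state can mask the value of [j]. *)
have [j0 lj0] := SCE l; rewrite mxE lj0.
move: lj; rewrite lj0 => /eqP eq_j; rewrite -eq_j.
by rewrite (negbTE neq_j'j) mul0r.
Qed.

End Separator.

Theorem proposition5 (R : realType) (nx nu ny ne : nat)
    (SA : 'M[bool]_nx) (SB : 'M[bool]_(nx, nu)) (SC : 'M[bool]_(ny + ne, nx))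
    (Hstruct : standing_assumption SB SC R)
    (Ua : {set 'I_nu}) (Ya : {set 'I_ny}) (i : 'I_nu) (Hi : i \in Ua) :
  type2_can_conduct R SA SB SC Ua Ya i <->
  vertex_separator (extended_edge SA SB SC)
    (state_sensor_nodes nu ne (driven_states SB (Ua :\ i)) Ya)
    (ActuatorN i) SinkN.
Proof.
case: Hstruct => -[s SBs] rkB [s' SCs].
have SBE j k : SB j k = (j == s k) by rewrite SBs mxE.
(* Full column rank of the structural matrix forces distinct actuators to drive distinct states. *)
have s_inj : injective s.
  apply: (@selection_rank_inj R); rewrite -[RHS]rkB; congr (\rank _).
  by apply/matrixP => j k; rewrite !mxE SBE.
(* An actuator is never adjacent to [t] and neither node lies in the set, so separation reduces to
   unreachability. *)
rewrite /vertex_separator ActuatorN_separator SinkN_separator /=.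
split; last exact: separator_can_conduct.
by apply: can_conduct_separator => // l; exists (s' l) => j; rewrite SCs mxE.
Qed.
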